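(* Every strongly null set $X\subseteq 2^{\omega}$ is perfectly null in the transitive sense. That is, if $X\subseteq 2^\omega$ is strongly null, then for every perfect set $P\subseteq 2^\omega$ there exists a $G_\delta$ set $G\supseteq X$ such that for every $t\in 2^\omega$ the set $(G+t)\cap P$ is $P$-null.
   Context: $2^\omega$ is the Cantor space with its usual metric ($d(x,y)=2^{-\min\{n: x(n)\neq y(n)\}}$ for $x\ne y$), viewed as a vector space over $\mathbb{Z}_2$ (coordinatewise addition mod 2); $A+t=\{a+t: a\in A\}$. A set $A\subseteq 2^\omega$ is strongly null if for every sequence $\langle\varepsilon_n\rangle_{n\in\omega}$ of positive reals there are open sets $A_n$ with $\operatorname{diam}A_n<\varepsilon_n$ for all $n$ and $A\subseteq\bigcup_{n}A_n$. Perfect set: a nonempty closed subset of $2^\omega$ without isolated points. For a perfect set $P$, let $T_P=\{x\restriction n: x\in P,n\in\omega\}$, and call $w\in T_P$ a branching point if $w^\frown 0,w^\frown 1\in T_P$; $\operatorname{Split}(P)$ is the set of branching points. The canonical order isomorphism $e_P:2^{<\omega}\to\operatorname{Split}(P)$ sends $\emptyset$ to the shortest branching point, and $w^\frown i$ to the shortest branching point extending $e_P(w)^\frown i$. The canonical homeomorphism $h_P:2^\omega\to P$ is $h_P(x)=\bigcup_n e_P(x\restriction n)$. Let $m$ be the standard product (Lebesgue) measure on $2^\omega$. The canonical measure on $P$ is $\mu_P(A)=m(h_P^{-1}[A])$ for $A\subseteq P$ with $h_P^{-1}[A]$ Lebesgue measurable; $A\subseteq P$ is $P$-null if $\mu_P(A)=0$.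 *)

(* Defs.v *)
From HB Require Import structures.
From mathcomp Require Import all_boot all_order all_algebra.
From mathcomp Require Import finmap.
From mathcomp Require Import all_classical all_reals all_analysis.
From mathcomp Require Import borel_hierarchy.

Set Implicit Arguments.
Unset Strict Implicit.
Unset Printing Implicit Defensive.

Import Order.TTheory GRing.Theory Num.Theory.
Import numFieldNormedType.Exports.

Local Open Scope classical_set_scope.
Local Open Scope ring_scope.

(* [mkseq x n] is the restriction of [x] to its first [n] coordinates. *)
Definition cylinder (s : seq bool) : set cantor_space :=
  [set x | mkseq x (size s) = s].

Lemma cylinder_nil : cylinder [::] = setT.
Proof. by apply/seteqP; split. Qed.

Lemma cylinder_rcons s b :
  cylinder (rcons s b) = cylinder s `&` [set x | x (size s) = b].
Proof.
by apply/seteqP; split=> x; rewrite /cylinder /= size_rcons mkseqS;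
  [move/rcons_inj => -[-> ->]|move=> [-> ->]].
Qed.

Lemma cylinder_split s :
  cylinder s = cylinder (rcons s false) `|` cylinder (rcons s true).
Proof.
rewrite !cylinder_rcons -setIUr; apply/esym/setIidPl => x _ /=.
by case: (x _); [right|left].
Qed.

Lemma clopen_cylinder s : clopen (cylinder s).
Proof.
elim/last_ind: s => [|s b IH].
  by rewrite cylinder_nil; split; [exact: openT|exact: closedT].
pose f : cantor_space -> bool := fun x => x (size s).
have cn : continuous f by exact: (@proj_continuous nat (fun=> bool) (size s)).
rewrite cylinder_rcons -/(f @^-1` [set b]); apply: clopenI => //; split.
  by apply: open_comp => [x _|]; [exact: cn|exact: discrete_open].
by apply: closed_comp => [x _|]; [exact: cn|exact: discrete_closed].
Qed.

Definition cantor_add (x t : cantor_space) : cantor_space :=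
  fun n => x n (+) t n.

Definition translate (A : set cantor_space) (t : cantor_space) :
  set cantor_space := [set cantor_add a t | a in A].

Section metric.
Variable R : realType.

(* The library puts only a topology and a uniformity on [cantor_space]. *)
Definition cantor_dist (x y : cantor_space) : R :=
  match pselect (exists n, x n != y n) with
  | left xy => 2^-1 ^+ ex_minn xy
  | right _ => 0
  end.

(* The set of distances is bounded by 1, and [sup set0 = 0]. *)
Definition diam (A : set cantor_space) : R :=
  sup [set d | exists x y, [/\ A x, A y & d = cantor_dist x y]].

Definition strongly_null (X : set cantor_space) : Prop :=
  forall eps : nat -> R, (forall n, 0 < eps n) ->
  exists A : nat -> set cantor_space,
    [/\ forall n, open (A n), forall n, diam (A n) < eps n &
        X `<=` \bigcup_n A n].

End metric.

Section product_measure.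
Variable R : realType.
Local Open Scope ereal_scope.

Definition cylinder_weight (s : seq bool) : \bar R := ((2^-1)%R ^+ size s)%:E.

(* Outer measure of the fair-coin product measure; the product measure itself
   is its restriction to the Caratheodory measurable sets, that is to the
   completion of the Borel sets (see [cantor_measure_cylinder]). *)
Definition cantor_outer (A : set cantor_space) : \bar R :=
  ereal_inf [set \sum_(k <oo) cylinder_weight (s k) |
    s in [set s : nat -> seq bool | A `<=` \bigcup_k cylinder (s k)]].

Lemma cylinder_weight_ge0 s : 0 <= cylinder_weight s.
Proof. by rewrite lee_fin exprn_ge0// invr_ge0. Qed.
Hint Resolve cylinder_weight_ge0 : core.

Lemma cantor_outer_ge0 A : 0 <= cantor_outer A.
Proof. by apply: le_ereal_inf_tmp => _ [s _ <-]; exact: nneseries_ge0. Qed.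

Lemma le_cantor_outer : {homo cantor_outer : A B / A `<=` B >-> A <= B}.
Proof.
move=> A B AB; apply/ereal_inf_le_tmp => _ [s Bs <-].
by exists s => //; exact: subset_trans AB Bs.
Qed.

Lemma small_cylinder_weights (e : R) : (0 < e)%R ->
  exists s : nat -> seq bool, \sum_(k <oo) cylinder_weight (s k) <= e%:E.
Proof.
move=> e0; have [N Ne] : exists N, ((2^-1)%R ^+ N <= e :> R)%R.
  have := @cvg_geometric R 1%R (2^-1)%R.
  rewrite ger0_norm ?invr_ge0// invf_lt1 ?ltr1n// => /(_ isT).
  move/cvgrPdist_le => /(_ e e0) [N _ /(_ N (leqnn N))] /=.
  rewrite /geometric /= mul1r sub0r normrN ger0_norm ?exprn_ge0 ?invr_ge0//.
  by exists N.
exists (fun k => nseq (N + k.+1)%N true).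
have := epsilon_trick xpredT (fun=> lexx (0 : \bar R)) (ltW e0).
rewrite [X in X + _]eseries0// add0e; apply: le_trans.
apply: lee_nneseries => // k _; rewrite add0e lee_fin size_nseq exprD.
by rewrite natrX -exprVn ler_wpM2r// exprn_ge0// invr_ge0.
Qed.

Lemma cantor_outer0 : cantor_outer set0 = 0.
Proof.
apply/eqP; rewrite eq_le cantor_outer_ge0 andbT.
apply/lee_addgt0Pr => e /small_cylinder_weights[s se]; rewrite add0e.
by apply: le_trans se; apply: ereal_inf_lbound; exists s => //; exact: sub0set.
Qed.

Lemma cantor_outer_sigma_subadditive : sigma_subadditive cantor_outer.
Proof.
move=> A; have [[i ioo]|] := pselect (exists i, cantor_outer (A i) = +oo).
  rewrite (eseries_pinfty _ _ ioo) ?leey// => n _.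
  by rewrite -ltNye (lt_le_trans _ (cantor_outer_ge0 _)).
rewrite -forallNE => Aoo.
apply/lee_addgt0Pr => _/posnumP[e].
rewrite (le_trans _ (epsilon_trick _ _ _))//; last first.
  by move=> n; exact: cantor_outer_ge0.
pose P n (s : nat -> seq bool) := A n `<=` \bigcup_k cylinder (s k) /\
  \sum_(k <oo) cylinder_weight (s k)
    <= cantor_outer (A n) + (e%:num / (2 ^ n.+1)%:R)%:E.
have [G PG] : {G : nat -> nat -> seq bool & forall n, P n (G n)}.
  apply: (@choice _ _ P) => n.
  have en1 : (0 < e%:num / (2 ^ n.+1)%:R)%R by [].
  have Afin : cantor_outer (A n) \is a fin_num.
    by rewrite ge0_fin_numE ?cantor_outer_ge0// ltey; apply/eqP/Aoo.
  have [_ [s As <-] sA] := lb_ereal_inf_adherent en1 Afin.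
  by exists s; split => //; exact: ltW.
pose w := cylinder_weight \o uncurry G.
have w_ge0 x : 0 <= w x by exact: cylinder_weight_ge0.
apply: (@le_trans _ _ (\esum_(i in setT) w i)).
  apply: ereal_inf_lbound => /=.
  have /card_esym/ppcard_eqP[f] := card_nat2.
  exists (uncurry G \o f).
    move=> t [i _ /(PG i).1 [j _ ?]]; exists (f^-1%FUN (i, j)) => //=.
    by rewrite invK ?inE.
  rewrite -(esum_pred_image w _ xpredT) ?[fun=> _]set_true//.
  by rewrite image_eq.
rewrite (_ : esum _ _ = \sum_(i <oo) \sum_(j <oo) cylinder_weight (G i j));
    last first.
  pose J : nat -> set (nat * nat) := fun i => [set (i, j) | j in setT].
  rewrite (_ : setT = \bigcup_k J k); last first.
    by rewrite predeqE => -[a b]; split => // _; exists a => //; exists b.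
  rewrite esum_bigcupT //=; last first.
    apply/trivIsetP => i j _ _ ij.
    rewrite predeqE => -[n m] /=; split => //= -[] [_] _ [<-{n} _].
    by move=> [m' _] [] /esym/eqP; rewrite (negbTE ij).
  rewrite -(image_id [set: nat]) -fun_true esum_pred_image//; last first.
    by move=> n _; exact: esum_ge0.
  apply: eq_eseriesr => /= j _.
  rewrite -(esum_pred_image w (pair j) predT)//=; last first.
    by move=> ? ? _ _; exact: (@can_inj _ _ _ snd).
  by congr esum; rewrite predeqE => -[a b]; split; move=> [i _ <-]; exists i.
apply: lee_nneseries => [n _ _|n _]; last exact: (PG n).2.
exact: nneseries_ge0.
Qed.

HB.instance Definition _ := isOuterMeasure.Build R cantor_space cantor_outer
  cantor_outer0 cantor_outer_ge0 le_cantor_outer cantor_outer_sigma_subadditive.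

Definition lebesgue_measurable (A : set cantor_space) : Prop :=
  cantor_outer.-cara.-measurable A.

Definition cantor_measure :
    set (caratheodory_type (cantor_outer : {outer_measure set _ -> \bar R})) ->
    \bar R :=
  (cantor_outer : {outer_measure set cantor_space -> \bar R}).

HB.instance Definition _ := Measure.on cantor_measure.

End product_measure.
Arguments cantor_measure : clear implicits.

Section product_measure_cylinder.
Variable R : realType.
Local Notation w := (cylinder_weight R).
Local Open Scope ereal_scope.

Lemma cylinder_weight_split s : w s = w (rcons s false) + w (rcons s true).
Proof.
rewrite /cylinder_weight !size_rcons -EFinD exprSr -mulrDr.
by rewrite -div1r -splitr mulr1.
Qed.

Lemma cantor_outer_cylinder_le s : cantor_outer R (cylinder s) <= w s.
Proof.
apply/lee_addgt0Pr => e /small_cylinder_weights[r re].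
pose u k := if k is k'.+1 then r k' else s.
apply: (@le_trans _ _ (\sum_(k <oo) w (u k))).
  by apply: ereal_inf_lbound; exists u => // x sx; exists 0%N.
rewrite nneseries_recl//= ?leeD2l//; last first.
  by move=> *; exact: cylinder_weight_ge0.
rewrite -nneseries_addn; last by move=> k; exact: cylinder_weight_ge0.
by under eq_eseriesr do rewrite addn1.
Qed.

Lemma measurable_coordinate n b :
  lebesgue_measurable R [set x : cantor_space | x n = b].
Proof.
set H := [set x | _].
have wH t : cantor_outer R (cylinder t `&` H) +
    cantor_outer R (cylinder t `&` ~` H) <= w t.
  have [d] := ubnP (n.+1 - size t)%N; elim: d t => // d IH t td.
  have [nt|tn] := ltnP n (size t).
    have tC x : cylinder t x -> x n = nth false t n.
      by rewrite /cylinder/= => <-; rewrite nth_mkseq// size_mkseq.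
    have [tb|tb] := eqVneq (nth false t n) b.
      rewrite [X in _ + cantor_outer R X](_ : _ = set0).
        rewrite cantor_outer0 adde0.
        apply: le_trans (cantor_outer_cylinder_le t).
        by apply: le_cantor_outer; exact: subIsetl.
      by rewrite -subset0 => x [/tC xt]; apply; rewrite /H/= xt.
    rewrite (_ : _ `&` H = set0).
      rewrite cantor_outer0 add0e.
      apply: le_trans (cantor_outer_cylinder_le t).
      by apply: le_cantor_outer; exact: subIsetl.
    by rewrite -subset0 => x [/tC xt]; rewrite /H/= xt; exact/eqP.
  rewrite cylinder_weight_split.
  have IHb c : cantor_outer R (cylinder (rcons t c) `&` H) +
    cantor_outer R (cylinder (rcons t c) `&` ~` H) <= w (rcons t c).
    by apply: IH; rewrite size_rcons subSS; move: td; rewrite subSn.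
  apply: le_trans (leeD (IHb false) (IHb true)).
  rewrite addeACA cylinder_split !setIUl; apply: leeD; exact: outer_measureU2.
apply: le_caratheodory_measurable => X.
apply: le_ereal_inf_tmp => _ [s Xs <-].
apply: (@le_trans _ _ (\sum_(k <oo) (cantor_outer R (cylinder (s k) `&` H) +
    cantor_outer R (cylinder (s k) `&` ~` H)))); last first.
  apply: lee_nneseries => k _ //.
  by move=> _; apply: adde_ge0; exact: cantor_outer_ge0.
rewrite nneseriesD; try by move=> *; exact: cantor_outer_ge0.
have sub Y : cantor_outer R (X `&` Y) <=
    \sum_(k <oo) cantor_outer R (cylinder (s k) `&` Y).
  have := @cantor_outer_sigma_subadditive R (fun k => cylinder (s k) `&` Y).
  apply: le_trans.
  by rewrite -setI_bigcupl; apply: le_cantor_outer; exact: setSI.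
by apply: leeD; exact: sub.
Qed.

Lemma measurable_cylinder s : lebesgue_measurable R (cylinder s).
Proof.
elim/last_ind: s => [|s b IH].
  by rewrite cylinder_nil; exact: measurableT.
by rewrite cylinder_rcons; apply: measurableI => //;
  exact: measurable_coordinate.
Qed.

Lemma cylinder_weight_finite_cover N (L : seq (seq bool)) s :
  {in L, forall t, (size t <= N)%N} ->
  (forall x, cylinder s x -> exists2 t, t \in L & cylinder t x) ->
  w s <= \sum_(t <- L) w t.
Proof.
have [d] := ubnP (N.+1 - size s)%N; elim: d s L => // d IH s L Nd LN sL.
have w0 := @cylinder_weight_ge0 R.
have [/hasP[t tL ts]|/hasPn nts] := boolP (has (fun t => prefix t s) L).
  rewrite (big_rem t)//=; apply: le_trans (leeDl _ _); last first.
    by apply: sume_ge0 => u _; exact: w0.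
  rewrite lee_fin ler_wiXn2l//.
  - by rewrite invf_le1 ?ler1n.
  - exact: size_prefix.
have key x t : cylinder s x -> t \in L -> cylinder t x -> (size s < size t)%N.
  move=> sx tL tx; rewrite ltnNge; apply: contra (nts t tL) => ts.
  rewrite prefixE -{1}sx -{2}tx /mkseq -map_take take_iota.
  by rewrite (minn_idPl ts).
have [x0 sx0] : exists x, cylinder s x.
  exists (nth false s); apply: (@eq_from_nth _ false); rewrite ?size_mkseq//.
  by move=> i i_s; rewrite nth_mkseq.
have [t0 t0L t0x] := sL _ sx0.
have st0 := key _ _ sx0 t0L t0x.
have t0N := LN _ t0L.
rewrite cylinder_weight_split.
pose L_ b := [seq t <- L | prefix (rcons s b) t].
have LE b : w (rcons s b) <= \sum_(t <- L_ b) w t.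
  apply: IH.
  - rewrite size_rcons subSS; move: Nd.
    rewrite subSn ?ltnS//; exact: leq_trans (ltnW st0) t0N.
  - by move=> t; rewrite mem_filter => /andP[_ /LN].
  - move=> x sbx; have sx : cylinder s x.
      by move: sbx; rewrite cylinder_rcons => -[].
    have [t tL tx] := sL _ sx; exists t => //.
    rewrite mem_filter tL andbT prefixE -{1}tx -{2}sbx /mkseq -map_take.
    rewrite take_iota.
    by rewrite size_rcons (minn_idPl (key _ _ sx tL tx)).
apply: le_trans (leeD (LE false) (LE true)) _.
rewrite !big_filter [X in _ + X]big_mkcond [X in X + _]big_mkcond -big_split /=.
apply: lee_sum => t _; case: ifPn => [ft|_]; last by case: ifP; rewrite ?add0e.
case: ifPn; rewrite ?adde0//.
move: ft; rewrite !prefixE !size_rcons => /eqP -> /eqP/rcons_inj[]//.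
Qed.

Lemma cantor_measure_cylinder s : cantor_measure R (cylinder s) = w s.
Proof.
apply/eqP; rewrite eq_le cantor_outer_cylinder_le/=.
apply: le_ereal_inf_tmp => _ [u su <-].
have : compact (cylinder s).
  apply: subclosed_compact cantor_space_compact _ => //.
  exact: (clopen_cylinder s).2.
rewrite compact_cover => /(_ nat setT (fun k => cylinder (u k))).
case; [by move=> k _; exact: (clopen_cylinder _).1|exact: su|].
move=> D _ sD.
have [n Dn] : exists n, forall k, k \in D -> (k < n)%N.
  exists (\max_(k <- finmap.enum_fset D) k).+1 => k kD; rewrite ltnS.
  exact: (@leq_bigmax_seq _ _ xpredT id).
apply: (@le_trans _ _ (\sum_(0 <= k < n) w (u k))); last first.
  by apply: nneseries_lim_ge => k _ _; exact: cylinder_weight_ge0.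
rewrite -(big_map u xpredT).
pose N := \max_(t <- map u (index_iota 0 n)) size t.
apply: (@cylinder_weight_finite_cover N).
  by move=> t tn; exact: (@leq_bigmax_seq _ _ xpredT size).
move=> x /sD[k /= kD kx]; exists (u k) => //; apply/map_f.
by rewrite mem_index_iota Dn.
Qed.

End product_measure_cylinder.

Section perfect.
Implicit Types P A : set cantor_space.

(* [perfect_set set0] holds in the library. *)
Definition perfect P : Prop := P !=set0 /\ perfect_set P.

Definition tree P : set (seq bool) :=
  [set w | exists x n, P x /\ w = mkseq x n].

Definition split_nodes P : set (seq bool) :=
  [set w | [/\ tree P w, tree P (rcons w false) & tree P (rcons w true)]].

(* When [P] is perfect, this is unique for every [u] in [tree P]. *)
Definition shortest_branching P (u : seq bool) : seq bool :=
  xget [::] [set w | [/\ split_nodes P w, prefix u w &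
    forall v, split_nodes P v -> prefix u v -> (size w <= size v)%N]].

(* [foldl] gives [e_iso P (rcons w i) =
   shortest_branching P (rcons (e_iso P w) i)]. *)
Definition e_iso P (w : seq bool) : seq bool :=
  foldl (fun v i => shortest_branching P (rcons v i))
    (shortest_branching P [::]) w.

(* The union of the finite sequences [e_iso P (mkseq x n)], as functions:
   its value at [i] is [true] iff one of them has a [true] at position [i]. *)
Definition h_iso P (x : cantor_space) : cantor_space :=
  fun i => `[< exists n, nth false (e_iso P (mkseq x n)) i = true >].

Variable R : realType.

Definition canonical_measure P (A : set cantor_space) : \bar R :=
  cantor_measure R (h_iso P @^-1` A).

Definition P_null P (A : set cantor_space) : Prop :=
  [/\ A `<=` P, lebesgue_measurable R (h_iso P @^-1` A) &
      canonical_measure P A = 0%E].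

Definition perfectly_null_transitive (X : set cantor_space) : Prop :=
  forall P, perfect P ->
  exists G : set cantor_space, [/\ Gdelta G, X `<=` G &
    forall t, P_null P (translate G t `&` P)].

End perfect.

(* Main.v *)
Require Import Defs.
From mathcomp Require Import all_boot all_order all_algebra.
From mathcomp Require Import all_classical all_reals all_analysis.

(** Fix a perfect set [P].  The point is that small diameter forces small
[P]-measure uniformly over all positions in the space.  There are only
finitely many branching points [e_iso P w] with [size w = n]; let [k] bound
their lengths.  If two points of [P] agree on their first [k] coordinates, then
they follow the same path through the first [n] branching points, so their
preimages under [h_iso P] lie in one cylinder of weight [2 ^- n]
([h_iso_agree]).  Hence for every [e > 0] there is a [k] such that every set
whose elements agree on [k] coordinates has [P]-measure at most [e]
([canonical_outer_agree]).

Translations preserve agreement on initial segments, so the bound is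
insensitive to them.  Given [e > 0], strong nullness covers [X] by open sets
[A n] whose diameters are so small that every translate of [A n] has
[P]-measure at most [e / 2 ^ n.+1]; their union is an open [V] containing [X],
all of whose translates have [P]-measure at most [e]
([strongly_null_open_cover]).  Intersecting such [V] over
[e = 1, 1 / 2, 1 / 3, ...] gives the required G-delta set.  All estimates are
made with the outer measure; measurability of the resulting null sets follows
from Caratheodory completeness. *)

Set Implicit Arguments.
Unset Strict Implicit.
Unset Printing Implicit Defensive.

Import Order.TTheory GRing.Theory Num.Theory.

Local Open Scope classical_set_scope.
Local Open Scope ring_scope.

(** * Initial segments *)

Lemma eq_mkseqP (x y : cantor_space) n :
  mkseq x n = mkseq y n <-> (forall i, (i < n)%N -> x i = y i).
Proof.
split=> [xy i ni|xy].
  by have := congr1 (nth false ^~ i) xy; rewrite !nth_mkseq.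
by apply/eq_in_map => i; rewrite mem_iota => /andP[_]; exact: xy.
Qed.

Lemma prefix_nth (u v : seq bool) i :
  prefix u v -> (i < size u)%N -> nth false v i = nth false u i.
Proof. by case/prefixP=> w -> iu; rewrite nth_cat iu. Qed.

Lemma first_difference (x y : cantor_space) :
  x <> y -> exists2 n, mkseq x n = mkseq y n & x n != y n.
Proof.
move=> xy; have ex : exists n, x n != y n.
  apply: contrapT => /forallNP eq_xy; apply: xy; apply/funext => n.
  by apply/eqP/negPn/negP/eq_xy.
case: (ex_minnP ex) => n dn min_n; exists n => //.
apply/eq_mkseqP => i ni; apply/eqP/negPn/negP => /min_n.
by rewrite leqNgt ni.
Qed.

(** Agreement on an initial segment replaces the metric: unlike a bound on the
diameter it needs no real numbers, and it is visibly translation invariant. *)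
Definition agree (k : nat) (A : set cantor_space) : Prop :=
  forall x y, A x -> A y -> mkseq x k = mkseq y k.

Lemma agree_translate k A t : agree k A -> agree k (translate A t).
Proof.
move=> kA _ _ [x Ax <-] [y Ay <-]; apply/eq_mkseqP => i ik.
by rewrite /cantor_add ((eq_mkseqP x y k).1 (kA _ _ Ax Ay) i ik).
Qed.

(** * Diameters and agreement on initial segments *)

Section diameter.
Variable R : realType.

Lemma cantor_dist_le1 x y : cantor_dist R x y <= 1.
Proof.
rewrite /cantor_dist; case: pselect => // xy.
by rewrite exprn_ile1// ?invr_ge0// invf_le1// ler1n.
Qed.

Lemma cantor_dist_lt_agree x y k :
  cantor_dist R x y < 2^-1 ^+ k -> mkseq x k = mkseq y k.
Proof.
have h0 : 0 < 2^-1 :> R by rewrite invr_gt0.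
have h1 : 2^-1 < 1 :> R by rewrite invf_lt1// ltr1n.
rewrite /cantor_dist; case: pselect => [xy|nxy _].
  case: ex_minnP => m _ min_m; rewrite ltr_iXn2l// => km.
  apply/eq_mkseqP => i ik; apply/eqP/negPn/negP => /min_m.
  by rewrite leqNgt (ltn_trans ik km).
apply/eq_mkseqP => i _; apply/eqP/negPn/negP => xyi.
by apply: nxy; exists i.
Qed.

Lemma diam_lt_agree A k : diam R A < 2^-1 ^+ k -> agree k A.
Proof.
move=> dA x y Ax Ay; apply: cantor_dist_lt_agree; apply: le_lt_trans dA.
apply: ub_le_sup; last by exists x, y.
by exists 1 => _ [a [b [_ _ ->]]]; exact: cantor_dist_le1.
Qed.

End diameter.

(** * The canonical map onto a perfect set *)

Section perfect_tree.
Variable P : set cantor_space.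
Hypothesis perfectP : perfect P.

(** Since [x] is not isolated in [P], another point of [P] agrees with it
beyond [u]; the place where they part is a branching point. *)
Lemma split_nodes_above u : tree P u ->
  exists2 v, split_nodes P v & prefix u v.
Proof.
move=> [x [k [Px ->]]].
have : limit_point P x by rewrite perfectP.2.2.
have xk : nbhs x (cylinder (mkseq x k)).
  apply: open_nbhs_nbhs; split; first exact: (clopen_cylinder _).1.
  by rewrite /cylinder /= size_mkseq.
move=> /(_ _ xk)[y [/eqP yx Py]]; rewrite /cylinder/= size_mkseq => yk.
have [n yxn dn] := first_difference yx.
exists (mkseq x n).
  have Pn : tree P (mkseq x n) by exists x, n.
  have Px1 : tree P (rcons (mkseq x n) (x n)) by exists x, n.+1; rewrite mkseqS.
  have Py1 : tree P (rcons (mkseq x n) (y n)).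
    by exists y, n.+1; rewrite mkseqS yxn.
  by move: dn Px1 Py1; case: (x n) (y n) => -[] // _ *; split.
have kn : (k <= n)%N.
  rewrite leqNgt; apply/negP => nk; move/eqP: dn; apply.
  by have /eq_mkseqP := yk; exact.
by rewrite prefixE size_mkseq /mkseq -map_take take_iota (minn_idPl kn).
Qed.

Lemma shortest_branchingP u : tree P u ->
  split_nodes P (shortest_branching P u) /\ prefix u (shortest_branching P u).
Proof.
move=> /split_nodes_above[v0 v0s uv0].
pose good m := `[< exists v, [/\ split_nodes P v, prefix u v & size v = m] >].
have ex : exists m, good m by exists (size v0); apply/asboolP; exists v0.
case: (ex_minnP ex) => m /asboolP[v [vs uv vm]] min_m.
rewrite /shortest_branching.
set S := [set w | _].
suff [] : S (xget [::] S) by [].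
apply: xgetPex; exists v; split=> // w ws uw; rewrite vm; apply: min_m.
by apply/asboolP; exists w.
Qed.

Lemma e_iso_rconsE w i :
  e_iso P (rcons w i) = shortest_branching P (rcons (e_iso P w) i).
Proof. by rewrite /e_iso foldl_rcons. Qed.

Lemma tree_nil : tree P [::].
Proof. by have [x Px] := perfectP.1; exists x, 0%N. Qed.

Lemma split_nodes_rcons w i : split_nodes P w -> tree P (rcons w i).
Proof. by case: i => -[]. Qed.

Lemma e_iso_split w : split_nodes P (e_iso P w).
Proof.
elim/last_ind: w => [|w i IH]; first exact: (shortest_branchingP tree_nil).1.
rewrite e_iso_rconsE.
by have [] := shortest_branchingP (split_nodes_rcons i IH).
Qed.

Lemma e_iso_prefix_rcons w i :
  prefix (rcons (e_iso P w) i) (e_iso P (rcons w i)).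
Proof.
rewrite e_iso_rconsE.
by have [] := shortest_branchingP (split_nodes_rcons i (e_iso_split w)).
Qed.

Lemma e_iso_prefix (x : cantor_space) m n : (m <= n)%N ->
  prefix (e_iso P (mkseq x m)) (e_iso P (mkseq x n)).
Proof.
elim: n => [|n IH]; first by rewrite leqn0 => /eqP ->; exact: prefix_refl.
rewrite leq_eqVlt => /predU1P[->|]; first exact: prefix_refl.
rewrite ltnS => /IH mn; apply: prefix_trans mn _.
rewrite [mkseq x n.+1]mkseqS; apply: prefix_trans (e_iso_prefix_rcons _ _).
exact: prefix_rcons.
Qed.

Lemma h_isoE (x : cantor_space) n i : (i < size (e_iso P (mkseq x n)))%N ->
  h_iso P x i = nth false (e_iso P (mkseq x n)) i.
Proof.
move=> i_n; rewrite /h_iso; apply/idP/idP => [/asboolP[m mi]|ni]; last first.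
  by apply/asboolP; exists n.
have i_m : (i < size (e_iso P (mkseq x m)))%N.
  by rewrite ltnNge; apply/negP => /(nth_default false); rewrite mi.
have [mn|/ltnW nm] := leqP m n.
  by rewrite (prefix_nth (e_iso_prefix x mn)).
by rewrite -(prefix_nth (e_iso_prefix x nm)).
Qed.

(** This is what makes [h_iso P] injective in a quantitative way: a point can
be read off its image, one coordinate at each branching point passed. *)
Lemma h_iso_branching (x : cantor_space) n :
  h_iso P x (size (e_iso P (mkseq x n))) = x n.
Proof.
have pr : prefix (rcons (e_iso P (mkseq x n)) (x n)) (e_iso P (mkseq x n.+1)).
  by rewrite mkseqS; exact: e_iso_prefix_rcons.
have sz : (size (e_iso P (mkseq x n)) <
    size (rcons (e_iso P (mkseq x n)) (x n)))%N.
  by rewrite size_rcons.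
rewrite (@h_isoE x n.+1).
  by rewrite (prefix_nth pr)// nth_rcons ltnn eqxx.
exact: leq_trans sz (size_prefix pr).
Qed.

(** By induction on [m <= n]: if [x] and [z] agree below [m], both images pass
through the same branching point, whose length is below [k], and the digit that
comes next in the common part of the images is the coordinate [m] of both. *)
Lemma h_iso_agree n k (x z : cantor_space) :
  (forall y : cantor_space, (size (e_iso P (mkseq y n)) <= k)%N) ->
  mkseq (h_iso P x) k = mkseq (h_iso P z) k -> mkseq x n = mkseq z n.
Proof.
move=> nk /eq_mkseqP hk.
suff H m : (m <= n)%N -> mkseq x m = mkseq z m by exact: H.
elim: m => // m IH mn; have xz := IH (ltnW mn).
rewrite !mkseqS {1}xz; congr rcons.
rewrite -[x m]h_iso_branching -[z m]h_iso_branching xz; apply: hk.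
apply: leq_trans (nk z).
(* The length at level [m.+1] is strictly larger than at level [m]. *)
apply: leq_trans (size_prefix (e_iso_prefix z mn)).
have := size_prefix (e_iso_prefix_rcons (mkseq z m) (z m)).
by rewrite size_rcons -mkseqS.
Qed.

Lemma e_iso_size_bounded n :
  exists k, forall y : cantor_space, (size (e_iso P (mkseq y n)) <= k)%N.
Proof.
exists (\max_(w : n.-tuple bool) size (e_iso P w))%N => y.
have sz : size (mkseq y n) == n by rewrite size_mkseq.
exact: (@leq_bigmax _ (fun w : n.-tuple bool => size (e_iso P w)) (Tuple sz)).
Qed.

End perfect_tree.

(** * Small sets have small canonical measure *)

Lemma half_expr_small (R : realType) (e : R) : 0 < e ->
  exists n, 2^-1 ^+ n <= e.
Proof.
move=> /ltr_add_invr[n]; rewrite add0r => /ltW ne; exists n.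
apply: le_trans ne; rewrite exprVn lef_pV2 ?posrE ?exprn_gt0//.
by rewrite -natrX ler_nat; exact: ltn_expl.
Qed.

(** If [B] meets [P], one preimage [z] of a point of [B] determines the first
[n] coordinates of all the others. *)
Lemma canonical_outer_agree (R : realType) P (e : R) : perfect P -> 0 < e ->
  exists k, forall B, agree k B ->
    (cantor_outer R (h_iso P @^-1` B) <= e%:E)%E.
Proof.
move=> perfectP e0; have [n ne] := half_expr_small e0.
have [k nk] := e_iso_size_bounded P n; exists k => B kB.
have [[z Bz]|] := pselect (h_iso P @^-1` B !=set0); last first.
  by move=> /set0P/negP/negPn/eqP ->; rewrite cantor_outer0 lee_fin ltW.
apply: (@le_trans _ _ (cylinder_weight R (mkseq z n))); last first.
  by rewrite lee_fin size_mkseq.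
apply: le_trans (cantor_outer_cylinder_le _ _); apply: le_cantor_outer => x Bx.
rewrite /cylinder /= size_mkseq.
by apply: (h_iso_agree perfectP nk); exact: kB.
Qed.

(** The open set [V] is chosen before the translation [t]; this is possible
because the length [k n] of agreement does not depend on where a set lies. *)
Lemma strongly_null_open_cover (R : realType) X P (e : R) :
  strongly_null R X -> perfect P -> 0 < e ->
  exists V, [/\ open V, X `<=` V & forall t,
    (cantor_outer R (h_iso P @^-1` translate V t) <= e%:E)%E].
Proof.
move=> snX perfectP e0.
have e2 n : 0 < e / (2 ^ n.+1)%:R by rewrite divr_gt0// ltr0n expn_gt0.
have [k kP] := choice (fun n => canonical_outer_agree perfectP (e2 n)).
have [|A [oA dA XA]] := snX (fun n => 2^-1 ^+ k n).
  by move=> n; rewrite exprn_gt0// invr_gt0.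
exists (\bigcup_n A n); split=> // [|t]; first exact: bigcup_open.
apply: (@le_trans _ _
    (\sum_(n <oo) cantor_outer R (h_iso P @^-1` translate (A n) t))%E).
  have := @cantor_outer_sigma_subadditive R
    (fun n => h_iso P @^-1` translate (A n) t).
  apply: le_trans.
  apply: le_cantor_outer => x [a [n _ Ana] ax].
  by exists n => //; exists a.
apply: le_trans (epsilon_trick0 xpredT (ltW e0)).
apply: lee_nneseries => n _; first by move=> _; exact: cantor_outer_ge0.
by apply: kP; apply: agree_translate; apply: diam_lt_agree; exact: dA.
Qed.

Theorem theorem3p3 (R : realType) (X : set cantor_space) :
  strongly_null R X -> perfectly_null_transitive R X.
Proof.
move=> snX P perfectP.
have e0 m : 0 < m.+1%:R^-1 :> R by rewrite invr_gt0.
have [V VP] := choice (fun m => strongly_null_open_cover snX perfectP (e0 m)).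
exists (\bigcap_m V m); split.
- by exists V => // m; have [] := VP m.
- by move=> x Xx m _; have [_ + _] := VP m; exact.
move=> t; rewrite /P_null /canonical_measure; set N := h_iso P @^-1` _.
have N0 : cantor_outer R N = 0%E.
  apply/eqP; rewrite eq_le cantor_outer_ge0 andbT.
  apply/lee_addgt0Pr => e /ltr_add_invr[m]; rewrite !add0r => me.
  apply: (@le_trans _ _ (m.+1%:R^-1)%:E); last by rewrite lee_fin ltW.
  have [_ _ /(_ t)] := VP m; apply: le_trans.
  apply: le_cantor_outer => x [[a Va ax] _].
  by exists a => //; exact: Va.
split=> [x []||] //.
apply: le_caratheodory_measurable => Y /=.
rewrite (_ : cantor_outer R (Y `&` N) = 0%E).
  by rewrite add0e; apply: le_cantor_outer; exact: subIsetl.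
apply/eqP; rewrite eq_le cantor_outer_ge0 andbT -N0.
by apply: le_cantor_outer; exact: subIsetr.
Qed.
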